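(* Let $J$ be an $n\times n$ Jacobi matrix with diagonal entries $b_1,\ldots,b_n$ and off-diagonal entries $a_1,\ldots,a_{n-1}$ satisfying $\operatorname{Im}b_1>0$, $b_k\in\mathbb{R}$ for $k=2,\ldots,n$, and $a_k>0$ for $k=1,\ldots,n-1$. If $z_0$ is an eigenvalue of $J$ of algebraic multiplicity $l$, then for all $j=1,\ldots,n$ the following relations hold: $$\left(\frac{1}{m_-(z,j+1)}\right)^{(p)}\Bigg|_{z=z_0}=a_j^2\,m_+^{(p)}(z_0,j),\qquad p=0,\ldots,l-1.$$
   Context: The Jacobi matrix $J$ has $b_k$ in position $(k,k)$ and $a_k$ in positions $(k,k+1)$ and $(k+1,k)$, zeros elsewhere. For $1\le k\le n$, $J_{[k,n]}$ denotes the matrix obtained from $J$ by deleting the top $k-1$ rows and the left $k-1$ columns, and $J_{[1,k]}$ denotes the $k\times k$ upper left corner of $J$ ($J_{[1,n]}=J$); rows and columns keep their indices from $J$, and $\delta_k$ is the standard basis vector with index $k$. Define the rational functions $$m_+(z,k-1)=\big((J_{[k,n]}-zI)^{-1}\delta_k,\delta_k\big),\quad k=1,\ldots,n,$$ $$m_-(z,k)=\big((J_{[1,k-1]}-zI)^{-1}\delta_{k-1},\delta_{k-1}\big),\quad k=2,\ldots,n+1.$$ Conventions: $a_n:=1$ and $m_+(z,n):\equiv0$. The superscript $(p)$ denotes the $p$-th derivative in $z$, and $1/m_-(z,j+1)$ is understood as a rational function of $z$. *)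

(* Defs.v *)
From HB Require Import structures.
From mathcomp Require Import all_boot all_order all_algebra fraction complex.
From mathcomp Require Import all_classical all_reals all_analysis.

Set Implicit Arguments.
Unset Strict Implicit.
Unset Printing Implicit Defensive.

Import Order.TTheory GRing.Theory Num.Theory.
Import numFieldNormedType.Exports.

Local Open Scope ring_scope.

(* The complex numbers over [R], typed as a [numClosedFieldType] so that the
   order, 'Im, and the normed topology of numeric fields are inferred.  In this
   order [0 < x] says that [x] is real and positive. *)
Definition Cplx (R : realType) : numClosedFieldType := R[i].

Section Jacobi.
Variable K : fieldType.
Implicit Types (a b : nat -> K).

(* Rows, columns and the sequences [a], [b] are indexed from 1. *)
Definition jacobi_entry a b (i j : nat) : K :=
  if i == j then b i
  else if j == i.+1 then a i
  else if i == j.+1 then a j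
  else 0.

(* The rows and columns s+1, ..., s+m of the Jacobi matrix; thus J_[k,r] is
   [jacobi_block a b k.-1 (r - k.-1)]. *)
Definition jacobi_block a b (s m : nat) : 'M[K]_m :=
  \matrix_(i < m, j < m) jacobi_entry a b (s + i.+1) (s + j.+1).

Definition jacobi a b (n : nat) : 'M[K]_n := jacobi_block a b 0 n.

(* The standard basis vector whose index in the full matrix is k, restricted to
   the indices s+1, ..., s+m. *)
Definition delta_vec (F : fieldType) (s m k : nat) : 'cV[F]_m :=
  \col_(i < m) (s + i.+1 == k)%:R.

Definition ratfun := {fraction {poly K}}.

(* ((M - z I)^-1 v, v) as a rational function of z: the resolvent is computed
   over the field K(z), where M - z I is invertible for every M.  The vectors
   used below have entries 0 and 1, so no conjugation occurs in ( , ). *)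
Definition resolvent_form (m : nat) (M : 'M[K]_m) (v : 'cV[ratfun]_m) : ratfun :=
  (v^T *m (invmx (map_mx (fun c : K => tofrac c%:P) M - (tofrac 'X)%:M) *m v))
    ord0 ord0.

(* m_+(z,k) involves J_[k+1,n] and has value 0 for k = n. *)
Definition m_plus a b (n k : nat) : ratfun :=
  if (k < n)%N then
    resolvent_form (jacobi_block a b k (n - k))
                   (delta_vec ratfun k (n - k) k.+1)
  else 0.

(* m_-(z,k) involves J_[1,k-1], for k >= 2. *)
Definition m_minus a b (k : nat) : ratfun :=
  resolvent_form (jacobi_block a b 0 k.-1) (delta_vec ratfun 0 k.-1 k.-1).

Definition rat_num (r : ratfun) : {poly K} :=
  let f := frac (repr r) in f.1 %/ gcdp f.1 f.2.

Definition rat_den (r : ratfun) : {poly K} :=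
  let f := frac (repr r) in f.2 %/ gcdp f.1 f.2.

(* z is not a pole of r; cancelling the common factors first means that a
   removable singularity of an expression for r is not a pole. *)
Definition rat_regular (r : ratfun) (z : K) : Prop := (rat_den r).[z] != 0.

(* Meaningful at the points where r is regular, and 0 at the poles of r. *)
Definition rat_eval (r : ratfun) (z : K) : K :=
  (rat_num r).[z] / (rat_den r).[z].

End Jacobi.

(* The p-th derivative of r at z, that is, of its function of the variable z. *)
Definition rat_derivn (K : numFieldType) (r : ratfun K) (p : nat) (z : K) : K :=
  derive1n p (rat_eval r : K -> K) z.

(* Main.v *)
(* Let P_k and Q_k be the characteristic polynomials of J_[1,k] and J_[k+1,n],
   with Q_(n+1) = 0.  Then 1/m_-(z,j+1) = - P_j/P_(j-1) and
   m_+(z,j) = - Q_(j+1)/Q_j, and splitting the continuant P_n at j gives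

     1/m_-(z,j+1) - a_j^2 m_+(z,j) = - P_n/(P_(j-1) Q_j),

   which vanishes to order l at z0 as soon as P_(j-1) Q_j does not vanish there.
   Dissipativity forces Im z0 > 0, whereas Q_j is the characteristic polynomial
   of a real symmetric matrix, so Q_j(z0) <> 0.  If P_(j-1)(z0) = 0, the splitting
   identity gives P_j(z0) = 0, and the three-term recurrence would then descend
   to P_0(z0) = 0. *)

Require Import Defs.
From HB Require Import structures.
From mathcomp Require Import all_boot all_order all_algebra fraction complex.
From mathcomp Require Import all_classical all_reals all_analysis.
From mathcomp Require Import ring zify.

Set Implicit Arguments.
Unset Strict Implicit.
Unset Printing Implicit Defensive.

Import Order.TTheory GRing.Theory Num.Theory.
Import numFieldNormedType.Exports.

Local Open Scope ring_scope.

(** Laplace expansion along the first row leaves two terms, and the second minor, expanded along its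
    first column, leaves one. For tridiagonal matrices this is the three-term recurrence. *)
Lemma det_corner (R : comPzRingType) (m : nat) (A : 'M[R]_m.+2) :
  (forall j, A ord0 (lift ord0 (lift ord0 j)) = 0) ->
  (forall i, A (lift ord0 (lift ord0 i)) ord0 = 0) ->
  \det A = A ord0 ord0 * \det (\matrix_(i, j) A (lift ord0 i) (lift ord0 j))
    - A ord0 (lift ord0 ord0) * A (lift ord0 ord0) ord0 *
      \det (\matrix_(i, j) A (lift ord0 (lift ord0 i)) (lift ord0 (lift ord0 j))).
Proof.
move=> Ar Ac; rewrite (expand_det_row _ ord0) !big_ord_recl.
rewrite big1 ?addr0 => [|i _]; last by rewrite Ar mul0r.
(* Once column 1 is deleted, column 0 keeps its place and the later columns start at column 2 of
   [A]. *)
have lift10 : lift (lift ord0 ord0) ord0 = ord0 :> 'I_m.+2 by exact: val_inj.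
have lift1S i : lift (lift ord0 ord0) (lift ord0 i) =
  lift ord0 (lift ord0 i) :> 'I_m.+2 by exact: val_inj.
congr (_ + _).
  rewrite /cofactor /= addn0 expr0 mul1r; congr (_ * \det _).
  by apply/matrixP=> i j; rewrite !mxE.
rewrite -mulrA -mulrN; congr (_ * _).
rewrite /cofactor /= expr1 mulN1r; congr (- _).
rewrite (expand_det_col _ ord0) big_ord_recl big1 ?addr0 => [|i _].
  rewrite !mxE lift10; congr (_ * _).
  rewrite /cofactor /= addn0 expr0 mul1r; congr (\det _).
  by apply/matrixP=> i j; rewrite !mxE lift1S.
by rewrite !mxE lift10 Ac mul0r.
Qed.

(** * Continuants of Jacobi blocks and the m-functions as their quotients *)

Section Blocks.
Variables (K : fieldType) (a b : nat -> K).

Local Notation D s m := (char_poly (jacobi_block a b s m)).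

Lemma char_poly_block0 s : D s 0 = 1.
Proof. exact: det_mx00. Qed.

Lemma char_poly_block1 s : D s 1 = 'X - (b s.+1)%:P.
Proof.
by rewrite /char_poly det_mx11 !mxE /= /jacobi_entry !addn1 !eqxx mulr1n.
Qed.

Lemma char_poly_blockSS s m :
  D s m.+2 = ('X - (b s.+1)%:P) * D s.+1 m.+1 - (a s.+1 ^+ 2)%:P * D s.+2 m.
Proof.
have entryS i j : jacobi_entry a b (s + i.+1) (s + j.+1) =
  if i == j then b (s + i.+1)%N else if j == i.+1 then a (s + i.+1)%N
  else if i == j.+1 then a (s + j.+1)%N else 0.
  by rewrite /jacobi_entry -!addnS !eqn_add2l !eqSS.
rewrite /char_poly det_corner; last 2 first.
- by move=> j; rewrite !mxE entryS /= mulr0n polyC0 subr0.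
- by move=> j; rewrite !mxE entryS /= mulr0n polyC0 subr0.
congr (_ * _ - _ * _).
- by rewrite !mxE entryS /= addn1 mulr1n.
- congr (\det _); apply/matrixP=> i j.
  by rewrite !mxE /= /bump !add1n !addSnnS.
- by rewrite !mxE !entryS /= !mulr0n !sub0r mulrNN -polyCM addn1 expr2.
- congr (\det _); apply/matrixP=> i j.
  by rewrite !mxE /= /bump !add1n !addSnnS.
Qed.

Lemma char_poly_block_split s m p :
  D s (m.+1 + p.+1) = D s m.+1 * D (s + m.+1) p.+1
    - (a (s + m.+1) ^+ 2)%:P * D s m * D (s + m.+2) p.
Proof.
(* The recurrence at the top row reaches back to blocks shorter by one and by two rows, hence strong
   induction on [m], with the offset [s] left free. *)
suff /(_ m.+1 m (ltnSn m)) : forall k m, (m < k)%N -> forall s,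
   D s (m.+1 + p.+1) = D s m.+1 * D (s + m.+1) p.+1
    - (a (s + m.+1) ^+ 2)%:P * D s m * D (s + m.+2) p by exact.
elim=> // k IH [|[|{}m]] ltmk {}s.
- rewrite !addnS addn0 char_poly_blockSS char_poly_block1 char_poly_block0.
  by rewrite mulr1.
- rewrite !addSn add0n char_poly_blockSS -(add1n p.+1) IH // addn1.
  rewrite [D s 2]char_poly_blockSS !char_poly_block1 !char_poly_block0.
  rewrite !addnS !addn0; ring.
- rewrite !addSn char_poly_blockSS -!addSn !IH; try lia.
  rewrite [D s m.+3]char_poly_blockSS [D s m.+2]char_poly_blockSS.
  rewrite !addSn !addnS; ring.
Qed.

Lemma char_poly_block_rcons s m :
  D s m.+2 = ('X - (b (s + m.+2))%:P) * D s m.+1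
    - (a (s + m.+1) ^+ 2)%:P * D s m.
Proof.
rewrite -[m.+2]addn1 char_poly_block_split char_poly_block1 char_poly_block0.
by rewrite mulr1 !addn1 !addnS [D s _ * _]mulrC.
Qed.

(** Cramer's rule: a diagonal entry of the inverse is a principal minor over the determinant, its
    cofactor sign being even. The minus sign comes from passing from M - z to z - M. *)
Lemma resolvent_form_delta (m : nat) (M : 'M[K]_m.+1) (i : 'I_m.+1)
    (v : 'cV[ratfun K]_m.+1) :
  v = delta_mx i 0 ->
  resolvent_form M v =
    - (tofrac (char_poly (row' i (col' i M))) / tofrac (char_poly M)).
Proof.
move=> ->; rewrite /resolvent_form trmx_delta.
set B := _ - _.
have -> : B = - 1 *: map_mx (@tofrac {poly K}) (char_poly_mx M).
  by apply/matrixP=> k l; rewrite !mxE rmorphB /= rmorphMn mulN1r opprB.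
have unitM : map_mx (@tofrac {poly K}) (char_poly_mx M) \in unitmx.
  by rewrite unitmxE det_map_mx unitfE tofrac_eq0 monic_neq0 ?char_poly_monic.
rewrite invmxZ ?unitmxZ ?unitrN1 // invrN invr1 scaleN1r mulNmx mulmxN.
rewrite -colE -rowE !mxE; congr (- _).
rewrite /invmx unitM !mxE mulrC det_map_mx cofactor_map_mx.
rewrite /cofactor addnn -signr_odd odd_double expr0 mul1r.
congr (tofrac (\det _) / _); apply/matrixP=> k l; rewrite !mxE.
by rewrite (inj_eq lift_inj).
Qed.

Lemma m_plusE n k : (k < n)%N ->
  m_plus a b n k =
    - (tofrac (D k.+1 (n - k.+1)) / tofrac (D k (n - k))).
Proof.
move=> ltkn; rewrite /m_plus ltkn -(subnSK ltkn).
rewrite (@resolvent_form_delta _ _ ord0).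
  congr (- (tofrac (char_poly _) / _)).
  by apply/matrixP=> i j; rewrite !mxE /= /bump !add1n !addSnnS.
apply/matrixP=> i j; rewrite !mxE ord1 eqxx andbT.
have := eqn_add2l k i.+1 1; rewrite addn1 eqSS => eq_ki.
by congr (_ *+ _); exact: congr1 eq_ki.
Qed.

Lemma m_minusE k :
  m_minus a b k.+2 = - (tofrac (D 0 k) / tofrac (D 0 k.+1)).
Proof.
rewrite /m_minus /= (@resolvent_form_delta _ _ ord_max).
  congr (- (tofrac (char_poly _) / _)).
  have bumpE (i : 'I_k) : bump k i = i by rewrite /bump leqNgt ltn_ord.
  by apply/matrixP=> i j; rewrite !mxE /= !bumpE.
by apply/matrixP=> i j; rewrite !mxE ord1 eqxx andbT add0r eqSS.
Qed.

End Blocks.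

(** * Location of the zeros of block characteristic polynomials *)

Section Roots.
Variables (C : numClosedFieldType) (a b : nat -> C).

Local Notation D s m := (char_poly (jacobi_block a b s m)).

(** Since a common zero makes all but the last term of the recurrence vanish and the [a k] are
    nonzero, it would pass down to the empty block, whose polynomial is 1. *)
Lemma block_consecutive_neq0 s m z :
  (forall k, (s < k <= s + m)%N -> a k != 0) ->
  (D s m.+1).[z] = 0 -> (D s.+1 m).[z] != 0.
Proof.
elim: m s => [|m IH] s a0 Ds0.
  by rewrite char_poly_block0 hornerC oner_eq0.
apply/eqP => DS0; move: (Ds0).
rewrite char_poly_blockSS !(hornerD, hornerN, hornerM, hornerC, hornerX).
rewrite DS0 mulr0 sub0r.
move/eqP; rewrite oppr_eq0 mulf_eq0 expf_eq0 /= (negPf (a0 _ _)); last by lia.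
apply/negP; apply: IH => // k hk; apply: a0; lia.
Qed.

Lemma block_consecutive_rcons_neq0 s m z :
  (forall k, (s < k <= s + m)%N -> a k != 0) ->
  (D s m.+1).[z] = 0 -> (D s m).[z] != 0.
Proof.
elim: m => [|m IH] a0 Ds0.
  by rewrite char_poly_block0 hornerC oner_eq0.
apply/eqP => DS0; move: (Ds0).
rewrite char_poly_block_rcons !(hornerD, hornerN, hornerM, hornerC, hornerX).
rewrite DS0 mulr0 sub0r.
move/eqP; rewrite oppr_eq0 mulf_eq0 expf_eq0 /= (negPf (a0 _ _)); last by lia.
apply/negP; apply: IH => // k hk; apply: a0; lia.
Qed.

(* The imaginary part of D s m.+1 / D s.+1 m (the reciprocal of the Weyl
   m-function up to sign), cleared of its denominator. *)
Let W s m z : C := 'Im ((D s m.+1).[z] * ((D s.+1 m).[z])^*).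

Lemma W0 s z : W s 0 z = 'Im z - 'Im (b s.+1).
Proof.
rewrite /W char_poly_block0 char_poly_block1 !hornerE rmorph1 mulr1.
exact: raddfB.
Qed.

(** This is the imaginary part of the continued fraction step F = z - b - a^2/F', multiplied by
    |p|^2. Conjugating p q^* reverses its imaginary part, which turns -a^2 into +a^2. *)
Lemma WS s m z : a s.+1 \is Num.real ->
  W s m.+1 z = ('Im z - 'Im (b s.+1)) * `|(D s.+1 m.+1).[z]| ^+ 2
    + a s.+1 ^+ 2 * W s.+1 m z.
Proof.
move=> aR; rewrite /W char_poly_blockSS.
rewrite !(hornerD, hornerN, hornerM, hornerC, hornerX).
set p := (D s.+1 m.+1).[z]; set q := (D s.+2 m).[z].
have -> : ((z - b s.+1) * p - a s.+1 ^+ 2 * q) * p^* =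
    `|p| ^+ 2 * (z - b s.+1) + - a s.+1 ^+ 2 * (p * q^*)^*.
  by rewrite normCK rmorphM /= conjCK; ring.
rewrite raddfD /= [in LHS]ImMl ?rpredX ?normr_real //.
rewrite [in LHS]ImMl ?rpredN ?rpredX // Im_conj [in LHS]raddfB /=.
by ring.
Qed.

Lemma W_gt0 s m z : 0 < 'Im z ->
  (forall k, (s < k <= s + m)%N -> a k \is Num.real) ->
  (forall k, (s < k <= s + m.+1)%N -> b k \is Num.real) -> 0 < W s m z.
Proof.
move=> zpos; elim: m s => [|m IH] s aR bR.
  by rewrite W0 (Creal_ImP _ (bR _ _)) ?subr0 //; lia.
have W1 : 0 < W s.+1 m z.
  by apply: IH => k hk; [apply: aR | apply: bR]; lia.
(* Positivity for the shorter block already excludes a zero here, so the first summand of [WS] is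
   strictly positive. *)
have D1 : (D s.+1 m.+1).[z] != 0.
  by apply: contraTneq W1 => D0; rewrite /W D0 mul0r raddf0 ltxx.
rewrite WS; last by apply: aR; lia.
rewrite (Creal_ImP _ (bR _ _)) ?subr0; last by lia.
apply: ltr_pwDl; first by rewrite mulr_gt0 ?exprn_gt0 ?normr_gt0.
apply: mulr_ge0; last exact: ltW.
by rewrite -realEsqr; apply: aR; lia.
Qed.

Lemma W_le0 s m z : 'Im z <= 0 ->
  (forall k, (s < k <= s + m)%N -> a k \is Num.real) ->
  (forall k, (s < k <= s + m.+1)%N -> b k \is Num.real) -> W s m z <= 0.
Proof.
move=> zneg; elim: m s => [|m IH] s aR bR.
  by rewrite W0 (Creal_ImP _ (bR _ _)) ?subr0 //; lia.
have W1 : W s.+1 m z <= 0.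
  by apply: IH => k hk; [apply: aR | apply: bR]; lia.
rewrite WS; last by apply: aR; lia.
rewrite (Creal_ImP _ (bR _ _)) ?subr0; last by lia.
apply: ler_wnDr; last by rewrite mulr_le0_ge0 ?exprn_ge0.
apply: mulr_ge0_le0 => //.
by rewrite -realEsqr; apply: aR; lia.
Qed.

Lemma real_block_neq0 s m z : 0 < 'Im z ->
  (forall k, (s < k < s + m)%N -> a k \is Num.real) ->
  (forall k, (s < k <= s + m)%N -> b k \is Num.real) -> (D s m).[z] != 0.
Proof.
case: m => [|m] zpos aR bR; first by rewrite char_poly_block0 hornerC oner_eq0.
have : 0 < W s m z by apply: W_gt0 => // k hk; apply: aR; lia.
by apply: contraTneq => D0; rewrite /W D0 mul0r raddf0 ltxx.
Qed.

(** If Im z <= 0, the corner entry contributes a strictly negative term to [W] and the remaining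
    real block a nonpositive one, so [W] < 0; but [W] vanishes at a root. *)
Lemma dissipative_block_root s m z :
  0 < 'Im (b s.+1) ->
  (forall k, (s < k <= s + m)%N -> 0 < a k) ->
  (forall k, (s.+1 < k <= s + m.+1)%N -> b k \is Num.real) ->
  (D s m.+1).[z] = 0 -> 0 < 'Im z.
Proof.
move=> b1 apos bR D0.
rewrite real_ltNge ?Creal_Im //; apply/negP => zneg.
have zb : 'Im z - 'Im (b s.+1) < 0 by rewrite subr_lt0 (le_lt_trans zneg).
have Wz : W s m z = 0 by rewrite /W D0 mul0r raddf0.
case: m apos bR D0 Wz => [|m] apos bR D0 Wz.
  by move: zb; rewrite -W0 Wz ltxx.
have aR k : (s < k <= s + m.+1)%N -> a k \is Num.real.
  by move=> hk; rewrite gtr0_real ?apos.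
have D1 : (D s.+1 m.+1).[z] != 0.
  by apply: (@block_consecutive_neq0 s) => // k hk; rewrite gt_eqF ?apos.
have W1 : W s.+1 m z <= 0.
  by apply: W_le0 => // k hk; [apply: aR | apply: bR]; lia.
suff : W s m.+1 z < 0 by rewrite Wz ltxx.
rewrite WS; last by apply: aR; lia.
apply: ltr_wnDr; last by rewrite nmulr_rlt0 // exprn_gt0 ?normr_gt0.
by rewrite mulr_ge0_le0 // exprn_ge0 // ltW ?apos //; lia.
Qed.

End Roots.

(** * Evaluation of rational functions through reduced fractions *)

Section RatEval.
Variable K : fieldType.

Lemma pi_ratio (R : idomainType) (x : {ratio R}) :
  \pi_{fraction R}%qT x = tofrac (frac x).1 / tofrac (frac x).2.
Proof.
rewrite /FracField.tofrac; unlock.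
rewrite -[X in _ = _ * X]FracField.pi_inv -[RHS]FracField.pi_mul.
apply/eqmodP; rewrite /= FracField.equivfE.
rewrite /FracField.mulf /FracField.invf.
rewrite !numden_Ratio ?mulf_neq0 ?oner_eq0 ?denom_ratioP //.
by rewrite mul1r mulr1 mulrC.
Qed.

(** The reduced denominator is coprime to the reduced numerator, so by Gauss it divides [q] and
    cannot vanish where [q] does not. *)
Lemma rat_eval_frac (p q : {poly K}) (z : K) : q.[z] != 0 ->
  rat_regular (tofrac p / tofrac q) z /\
  rat_eval (tofrac p / tofrac q) z = p.[z] / q.[z].
Proof.
move=> qz.
have q0 : q != 0 by apply: contraNneq qz => ->; rewrite horner0.
rewrite /rat_regular /rat_eval /rat_num /rat_den.
set r := _ / _; have := reprK r; case: (repr r) => -[f g] /= g0 fgE.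
have fqE : f * q = p * g.
  have /eqP := fgE; rewrite pi_ratio /= eqr_div ?tofrac_eq0 //.
  by rewrite -!tofracM tofrac_eq => /eqP.
set h := gcdp f g.
have h0 : h != 0 by rewrite gcdp_eq0 negb_and g0 orbT.
have fE : f = f %/ h * h by rewrite divpK ?dvdp_gcdl.
have gE : g = g %/ h * h by rewrite divpK ?dvdp_gcdr.
have {}fqE : (f %/ h) * q = p * (g %/ h).
  by apply: (mulIf h0); rewrite mulrAC -fE -mulrA -gE.
have gh : g %/ h %| q.
  rewrite -(@Gauss_dvdpr _ _ (f %/ h)) ?fqE ?dvdp_mull //.
  by rewrite coprimep_sym coprimep_div_gcd // g0 orbT.
have ghz : (g %/ h).[z] != 0.
  apply: contra qz => /eqP ghz; have /dvdpP[u ->] := gh.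
  by rewrite hornerM ghz mulr0.
split=> //; apply/eqP; rewrite eqr_div //; apply/eqP.
by rewrite -!hornerM fqE.
Qed.

End RatEval.

(** * Higher derivatives of quotients and order of contact *)

Section Derivatives.
Variable K : numFieldType.
Implicit Types (u v : {poly K} * {poly K}) (z : K).

Let quot u z : K := u.1.[z] / u.2.[z].

(* The quotient rule on numerator-denominator pairs. *)
Let quot_deriv u := (u.1^`() * u.2 - u.1 * u.2^`(), u.2 ^+ 2).

Lemma is_derive_horner (p : {poly K}) z :
  is_derive (z : K^o) (1 : K^o) (horner p : K^o -> K^o) p^`().[z].
Proof.
elim/poly_ind: p => [|p c IH].
  have -> : horner (0 : {poly K}) = cst 0 by apply/funext => y; rewrite horner0.
  by rewrite deriv0 horner0; exact: is_derive_cst.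
have -> : horner (p * 'X + c%:P) = horner p * id + cst c.
  by apply/funext => y; rewrite !hornerE.
rewrite derivD derivC addr0 derivM derivX mulr1.
apply: is_derive_eq.
by rewrite addr0 !hornerE /= /GRing.scale /=; ring.
Qed.

Lemma near_horner_neq0 (q : {poly K}) z : q.[z] != 0 ->
  \forall x \near z, q.[x] != 0.
Proof.
move=> qz.
have qc : {for z, continuous (horner q : K^o -> K^o)}.
  apply/differentiable_continuous/derivable1_diffP.
  by case: (is_derive_horner q z).
exact: cvgr_neq0 qc qz.
Qed.

Lemma derive1_quot u z : u.2.[z] != 0 ->
  (quot u)^`()%classic z = quot (quot_deriv u) z.
Proof.
move=> uz.
have [d1 D1] := is_derive_horner u.1 z.
have [d2 D2] := is_derive_horner u.2 z.
have dV := derivableV uz d2.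
rewrite derive1E.
have -> : quot u = horner u.1 * (fun y => u.2.[y]^-1) by [].
rewrite deriveM // deriveV // D1 D2 /quot /quot_deriv /= !hornerE.
rewrite /GRing.scale /=.
by field.
Qed.

Lemma iter_quot_deriv_den u p z : u.2.[z] != 0 ->
  (iter p quot_deriv u).2.[z] != 0.
Proof. by move=> uz; elim: p => //= p IH; rewrite horner_exp expf_neq0. Qed.

(** Agreement is assumed wherever [u.2] is nonzero because differentiation needs it on a
    neighbourhood. The iterated denominators are powers of [u.2], so the same open set serves every
    [p]. *)
Lemma derive1n_quot (f : K -> K) u p z :
  (forall x, u.2.[x] != 0 -> f x = quot u x) -> u.2.[z] != 0 ->
  derive1n p f z = quot (iter p quot_deriv u) z.
Proof.
move=> fE; elim: p z => [|p IH] z uz; first exact: fE.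
rewrite derive1nS iterS -derive1_quot ?iter_quot_deriv_den // !derive1E.
apply: near_eq_derive; apply: filterS (near_horner_neq0 uz) => x; exact: IH.
Qed.

Lemma quot_eq_root u v c z : u.2.[z] != 0 -> v.2.[z] != 0 ->
  root (u.1 * v.2 - c%:P * (v.1 * u.2)) z -> quot u z = c * quot v z.
Proof.
move=> uz vz; rewrite rootE hornerD hornerN !hornerM hornerC subr_eq0.
move=> /eqP uvE.
by rewrite /quot mulrA; apply/eqP; rewrite eqr_div // uvE mulrA.
Qed.

(** The hypothesis concerns the numerator N of u - c v over the denominator u.2 v.2. The new
    numerator is the quotient rule applied to this fraction, so only the term with N' loses one
    order. *)
Lemma dvdp_quot_deriv u v c z l :
  ('X - z%:P) ^+ l.+1 %| u.1 * v.2 - c%:P * (v.1 * u.2) ->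
  ('X - z%:P) ^+ l %| (quot_deriv u).1 * (quot_deriv v).2
    - c%:P * ((quot_deriv v).1 * (quot_deriv u).2).
Proof.
move=> dvdN; set N := _ * _ - _ in dvdN.
have -> : (quot_deriv u).1 * (quot_deriv v).2
    - c%:P * ((quot_deriv v).1 * (quot_deriv u).2) =
    N^`() * (u.2 * v.2) - N * (u.2 * v.2)^`().
  by rewrite /N /quot_deriv /= derivB !derivM derivC; ring.
apply: dvdp_sub; last by rewrite dvdp_mulr // (dvdp_trans _ dvdN) ?dvdp_exp2l.
rewrite dvdp_mulr //; have /dvdpP[w ->] := dvdN.
rewrite derivM deriv_exp derivXsubC mul1r /=.
apply: dvdp_add; apply: dvdp_mull; first by rewrite dvdp_exp2l.
by rewrite -mulr_natr dvdp_mulr.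
Qed.

Lemma dvdp_iter_quot_deriv u v c z p l :
  ('X - z%:P) ^+ (p + l) %| u.1 * v.2 - c%:P * (v.1 * u.2) ->
  ('X - z%:P) ^+ l %|
    (iter p quot_deriv u).1 * (iter p quot_deriv v).2
      - c%:P * ((iter p quot_deriv v).1 * (iter p quot_deriv u).2).
Proof.
elim: p l => [//|p IH] l dvdN.
by rewrite !iterS; apply/dvdp_quot_deriv/IH; rewrite addnS.
Qed.

Lemma eq_rat_derivn u v c z l p : u.2.[z] != 0 -> v.2.[z] != 0 ->
  ('X - z%:P) ^+ l %| u.1 * v.2 - c%:P * (v.1 * u.2) -> (p < l)%N ->
  rat_derivn (tofrac u.1 / tofrac u.2) p z =
    c * rat_derivn (tofrac v.1 / tofrac v.2) p z.
Proof.
move=> uz vz dvdN ltpl; rewrite /rat_derivn.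
rewrite (@derive1n_quot _ u) ?(@derive1n_quot _ v) //; last 2 first.
- by move=> x vx; case: (rat_eval_frac v.1 vx).
- by move=> x ux; case: (rat_eval_frac u.1 ux).
apply: quot_eq_root; rewrite ?iter_quot_deriv_den // -dvdp_XsubCl.
(* After [p] derivatives, [p.+1] initial factors leave one, which is enough for equality of values
   at [z]. *)
rewrite -['X - _]expr1; apply: dvdp_iter_quot_deriv.
by apply: dvdp_trans dvdN; rewrite dvdp_exp2l // addn1.
Qed.

End Derivatives.

Theorem theorem4p8 (R : realType) (n : nat) (a b : nat -> Cplx R)
    (hn : (0 < n)%N)
    (hb1 : 0 < 'Im (b 1%N))
    (hb : forall k : nat, (2 <= k <= n)%N -> b k \is Num.real)
    (ha : forall k : nat, (1 <= k < n)%N -> 0 < a k)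
    (han : a n = 1)
    (z0 : Cplx R) (l : nat)
    (hz0 : eigenvalue (jacobi a b n) z0)
    (hl : mup z0 (char_poly (jacobi a b n)) = l) :
  forall j : nat, (1 <= j <= n)%N ->
    [/\ rat_regular (m_minus a b j.+1)^-1 z0,
        rat_regular (m_plus a b n j) z0
      & forall p : nat, (p < l)%N ->
          rat_derivn (m_minus a b j.+1)^-1 p z0
            = a j ^+ 2 * rat_derivn (m_plus a b n j) p z0].
Proof.
move=> [//|i] /andP[_ lein].
have a0 k : (1 <= k < n)%N -> a k != 0 by move=> hk; rewrite gt_eqF ?ha.
have D0 : (char_poly (jacobi_block a b 0 n)).[z0] = 0.
  by apply/eqP; rewrite -[_ == 0]/(root _ z0) -eigenvalue_root_char.
have z0pos : 0 < 'Im z0.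
  case: n hn hb ha D0 {han hz0 hl lein a0} => // m _ hb ha D0.
  exact: (dissipative_block_root _ _ _ D0).
(* With j = i+1, this pair represents 1/m_-(z,j+1) = -P_j/P_(j-1). *)
pose u := (- char_poly (jacobi_block a b 0 i.+1),
           char_poly (jacobi_block a b 0 i)).
have mE : (m_minus a b i.+2)^-1 = tofrac u.1 / tofrac u.2.
  by rewrite m_minusE invrN invf_div /= tofracN mulNr.
(* The pair [v] represents m_+(z,j), chosen so that the cross-multiplied difference is exactly -P_n,
   which carries the multiplicity [l]. *)
have [v [pE vz uvE]] : exists v : {poly Cplx R} * {poly Cplx R},
    [/\ m_plus a b n i.+1 = tofrac v.1 / tofrac v.2, v.2.[z0] != 0
      & u.1 * v.2 - (a i.+1 ^+ 2)%:P * (v.1 * u.2) = - char_poly (jacobi a b n)].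
  have [ltin|geni] := ltnP i.+1 n.
    exists (- char_poly (jacobi_block a b i.+2 (n - i.+2)),
            char_poly (jacobi_block a b i.+1 (n - i.+1))); split.
    - by rewrite m_plusE // tofracN mulNr.
    - apply: real_block_neq0 => // k hk.
        by apply/gtr0_real/ha; lia.
      by apply: hb; lia.
    - have nE : n = (i.+1 + (n - i.+2).+1)%N by lia.
      rewrite /jacobi [in RHS]nE char_poly_block_split !add0n.
      by rewrite -(subnSK ltin) /=; ring.
  (* For j = n the zero function is written 0/1, and the difference reduces to the numerator -P_n of
     [u]. *)
  have ein : i.+1 = n by lia.
  exists (0, 1); split => /=.
  - by rewrite /m_plus ltnNge geni tofrac0 mul0r.
  - by rewrite hornerC oner_eq0.
  - by rewrite mul0r mulr0 subr0 mulr1 /= ein.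
have uz : u.2.[z0] != 0.
  (* If P_(j-1) vanished at [z0], evaluating [uvE] there would force P_j to vanish too, giving two
     consecutive continuants a common zero. *)
  apply/negP => /eqP u0.
  have := congr1 (horner^~ z0) uvE.
  rewrite /= !(hornerD, hornerN, hornerM) u0 !mulr0 subr0 D0 oppr0 mulNr.
  move/eqP; rewrite oppr_eq0 mulf_eq0 (negPf vz) orbF => /eqP Di.
  have /negP[] : u.2.[z0] != 0; last by rewrite u0.
  by apply: block_consecutive_rcons_neq0 Di => k hk; apply: a0; lia.
split.
- by rewrite mE; case: (rat_eval_frac u.1 uz).
- by rewrite pE; case: (rat_eval_frac v.1 vz).
- move=> p ltpl; rewrite mE pE; apply: (eq_rat_derivn uz vz _ ltpl).
  by rewrite uvE dvdpNr -hl -mup_geq // monic_neq0 // char_poly_monic.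
Qed.
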